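(* Let $\alpha\le\gamma$ be compositions of $n$. At $t=1$, $$\overleftarrow{\omega}\left(\mathbf{R}^{(\gamma)}_\alpha(A;1)\right)=\mathbf{R}^{(\overleftarrow{\gamma})}_{\overleftarrow{\alpha}}(A;1).$$
   Context: A composition $\alpha=(\alpha_1,\ldots,\alpha_{l(\alpha)})$ of $n$ is a sequence of positive integers with sum $n$; $l(\alpha)$ is its length. Its descent set is $D(\alpha)=\{\alpha_1,\alpha_1+\alpha_2,\ldots,\alpha_1+\cdots+\alpha_{l(\alpha)-1}\}\subseteq\{1,\ldots,n-1\}$; this gives a bijection between compositions of $n$ and subsets of $\{1,\ldots,n-1\}$. Refinement order on compositions of $n$: $\alpha\le\beta$ iff $D(\beta)\subseteq D(\alpha)$. The complement $\alpha^c$ is the composition of $n$ with $D(\alpha^c)=\{1,\ldots,n-1\}\setminus D(\alpha)$; the reverse is $\overleftarrow{\alpha}=(\alpha_{l(\alpha)},\ldots,\alpha_1)$. For compositions $\alpha,\beta$ of $n$, $c(\alpha,\beta)=\sum_{i\in D(\alpha)\cap D(\beta)}i$. $\mathbf{Sym}=\mathbb{C}(q,t)\langle\mathbf{h}_1,\mathbf{h}_2,\ldots\rangle$ is the free associative algebra of non-commutative symmetric functions; $\mathbf{h}_\alpha(A)=\mathbf{h}_{\alpha_1}\cdots\mathbf{h}_{\alpha_{l(\alpha)}}$. The ribbon Schur functions $\mathbf{R}_\alpha(A)=\sum_{\beta\ge\alpha}(-1)^{l(\alpha)-l(\beta)}\mathbf{h}_\beta(A)$ form a basis. The map $\overleftarrow{\omega}$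 is the linear involution of $\mathbf{Sym}$ with $\overleftarrow{\omega}(\mathbf{R}_\alpha(A))=\mathbf{R}_{\overleftarrow{\alpha}}(A)$. For compositions $\alpha\le\gamma$ of $n$, the $\gamma$-ribbon Schur function is $$\mathbf{R}_\alpha^{(\gamma)}(A;t)=\sum_{\substack{\beta\ge\alpha\\ D(\alpha)\setminus D(\beta)\subseteq D(\gamma)}}t^{c(\alpha,\beta^c)}\mathbf{R}_\beta(A),$$ and $\mathbf{R}_\alpha^{(\gamma)}(A;1)$ is its specialization at $t=1$. *)

(* Defs.v *)
(* Mathematical Components, with multinomials for free algebras *)
From HB Require Import structures.
From mathcomp Require Import all_boot all_order all_algebra fraction.
From mathcomp Require Import reals complex monalg.

Set Implicit Arguments.
Unset Strict Implicit.
Unset Printing Implicit Defensive.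

Import GRing.Theory.
Local Open Scope ring_scope.

Section Compositions.

Variable n : nat.

Record composition := Composition {
  parts :> seq nat;
  _ : (0%N \notin parts) && (sumn parts == n)
}.

HB.instance Definition _ := [isSub for parts].

Implicit Types (a b g : composition) (S : {set 'I_n}).

Lemma parts_gt0 a : 0%N \notin parts a.
Proof. by case: a => s /= /andP[]. Qed.

Lemma sumn_parts a : sumn a = n.
Proof. by case: a => s /= /andP[_ /eqP]. Qed.

Definition partial_sums (s : seq nat) : seq nat :=
  [seq sumn (take k s) | k <- iota 1 (size s).-1].

(* Subsets of {1, ..., n-1} are the sets of 'I_n that do not contain 0. *)
Definition descents a : {set 'I_n} :=
  [set i : 'I_n | val i \in partial_sums a].

(* The composition with a given descent set (0 is ignored): the successive
   differences of 0 < i_1 < ... < i_k < n. *)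
Definition set_parts S : seq nat :=
  if n == 0%N then [::]
  else pairmap (fun x y => y - x)%N 0%N
         (rcons [seq val i | i <- enum S & (0 < val i)%N] n).

Lemma sorted_set S :
  path ltn 0%N [seq val i | i <- enum S & (0 < val i)%N].
Proof.
rewrite path_sortedE; last exact: ltn_trans.
apply/andP; split.
  by apply/allP=> x /mapP[j]; rewrite mem_filter => /andP[j_gt0 _] ->.
have sub : subseq [seq val i | i <- enum S & (0 < val i)%N] (iota 0 n).
  rewrite -val_enum_ord; apply: map_subseq.
  apply: subseq_trans (filter_subseq _ _) _.
  by rewrite [enum S]/enum_mem -enumT; apply: filter_subseq.
by apply: subseq_sorted sub (iota_ltn_sorted 0 n); apply: ltn_trans.
Qed.

Lemma path_rcons_set S : (0 < n)%N ->
  path ltn 0%N (rcons [seq val i | i <- enum S & (0 < val i)%N] n).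
Proof.
move=> n_gt0; rewrite rcons_path sorted_set /=.
have : all (gtn n) (0%N :: [seq val i | i <- enum S & (0 < val i)%N]).
  by rewrite /= n_gt0; apply/allP=> x /mapP[j _ ->] /=.
by move/allP; apply; rewrite mem_last.
Qed.

Lemma pairmap_subn_gt0 x s : path ltn x s ->
  0%N \notin pairmap (fun x y => y - x)%N x s.
Proof.
elim: s x => //= y s IHs x /andP[lt_xy pth].
by rewrite inE negb_or IHs // andbT eq_sym subn_eq0 -ltnNge.
Qed.

Lemma scanl_pairmap_subn x s : path ltn x s ->
  scanl addn x (pairmap (fun x y => y - x)%N x s) = s.
Proof.
elim: s x => //= y s IHs x /andP[lt_xy pth].
by rewrite subnKC ?IHs // ltnW.
Qed.

Lemma last_scanl_addn x s : last x (scanl addn x s) = (x + sumn s)%N.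
Proof. by elim: s x => [|y s IHs] x /=; rewrite ?addn0 // IHs addnA. Qed.

Lemma set_partsP S :
  (0%N \notin set_parts S) && (sumn (set_parts S) == n).
Proof.
rewrite /set_parts; have [n0|n_gt0] := posnP n; first by rewrite /= n0 eqxx.
have pth := path_rcons_set S n_gt0.
rewrite pairmap_subn_gt0 //=.
have := last_scanl_addn 0
  (pairmap (fun x y => y - x)%N 0%N
    (rcons [seq val i | i <- enum S & (0 < val i)%N] n)).
by rewrite scanl_pairmap_subn // last_rcons add0n => <-.
Qed.

Definition comp_of_set S : composition := Composition (set_partsP S).

Lemma partial_sums_scanl s : s != [::] ->
  rcons (partial_sums s) (sumn s) = scanl addn 0%N s.
Proof.
move=> s_n0; have s_gt0 : (0 < size s)%N by case: (s) s_n0.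
have sumE u : foldl addn 0%N u = sumn u.
  by rewrite -[sumn u]add0n -last_scanl_addn; elim: u 0%N => //=.
apply: (@eq_from_nth _ 0%N).
  by rewrite size_rcons size_map size_iota size_scanl prednK.
move=> i; rewrite size_rcons size_map size_iota prednK // => lt_i.
rewrite nth_scanl // sumE nth_rcons size_map size_iota.
case: ltngtP => [lti|gti|->].
- by rewrite (nth_map 0%N) ?size_iota // nth_iota // add1n.
- by move: lt_i; rewrite -(prednK s_gt0) ltnS leqNgt gti.
- by rewrite prednK // take_size.
Qed.

Lemma path_scanl_addn x s : 0%N \notin s -> path ltn x (scanl addn x s).
Proof.
elim: s x => //= y s IHs x; rewrite inE negb_or eq_sym => /andP[y0 s0].
by rewrite -[X in (X < _)%N]addn0 ltn_add2l lt0n y0 IHs.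
Qed.

Lemma comp_neq_nil a : (0 < n)%N -> parts a != [::].
Proof. by apply: contraTneq => a0; rewrite -(sumn_parts a) a0. Qed.

Lemma comp0 a : n = 0%N -> parts a = [::].
Proof.
move=> n0; have := sumn_parts a; have := parts_gt0 a; rewrite n0.
by case: (parts a) => // -[|x] s.
Qed.

Lemma path_partial_sums a : (0 < n)%N ->
  path ltn 0%N (rcons (partial_sums a) n).
Proof.
move=> n_gt0.
rewrite -[X in rcons _ X](sumn_parts a) partial_sums_scanl ?comp_neq_nil //.
exact: path_scanl_addn (parts_gt0 a).
Qed.

Lemma partial_sums_bound a x :
  x \in partial_sums a -> (0 < x < n)%N.
Proof.
case: (posnP n) => [/(comp0 a)->//|n_gt0] xP.
have := path_partial_sums a n_gt0.
rewrite (path_sortedE ltn_trans) all_rcons => /andP[/andP[_ /allP/(_ _ xP)->]].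
rewrite (sorted_pairwise ltn_trans) -cats1 pairwise_cat allrel1r.
by case/andP=> /allP/(_ _ xP).
Qed.

Lemma descentsK : cancel descents comp_of_set.
Proof.
move=> a; apply/val_inj; rewrite /= /set_parts.
case: (posnP n) => [n0|n_gt0].
  by rewrite (comp0 a n0).
have pth := path_partial_sums a n_gt0.
have -> : [seq val i | i <- enum (descents a) & (0 < val i)%N]
          = partial_sums a.
  apply: (irr_sorted_eq ltn_trans ltnn).
  - exact: path_sorted (sorted_set _).
  - by move/path_sorted: pth; rewrite -cats1 => /cat_sorted2[].
  - move=> x; apply/mapP/idP => [[j]|xP].
      by rewrite mem_filter mem_enum inE => /andP[_ ?] ->.
    have /andP[x_gt0 x_lt] := partial_sums_bound xP.
    by exists (Ordinal x_lt); rewrite // mem_filter mem_enum inE /= x_gt0.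
rewrite -[X in rcons _ X](sumn_parts a) partial_sums_scanl ?comp_neq_nil //.
by apply: scanlK => x y; rewrite addKn.
Qed.

Lemma comp_of_setK S :
  descents (comp_of_set S) = [set i in S | (0 < val i)%N].
Proof.
case: (posnP n) => [n0|n_gt0].
  by apply/setP=> i; have := ltn_ord i; rewrite {2}n0.
have pth := path_rcons_set S n_gt0.
have := partial_sums_scanl (comp_neq_nil (comp_of_set S) n_gt0).
have partsE : parts (comp_of_set S) = pairmap (fun x y => y - x)%N 0%N
   (rcons [seq val i | i <- enum S & (0 < val i)%N] n).
  by rewrite /= /set_parts gtn_eqF.
rewrite [X in _ = scanl _ _ X]partsE scanl_pairmap_subn // => /rcons_inj[psE _].
apply/setP=> i; rewrite !inE psE mem_map; last exact: val_inj.
by rewrite mem_filter mem_enum andbC.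
Qed.

HB.instance Definition _ := Finite.copy composition (can_type descentsK).

(* a <= b in the refinement order. *)
Definition refines a b : bool := descents b \subset descents a.

Definition compl_comp a : composition := comp_of_set (~: descents a).

Lemma descents_compl a :
  descents (compl_comp a) = [set i : 'I_n | (0 < val i)%N] :\: descents a.
Proof. by rewrite comp_of_setK; apply/setP=> i; rewrite !inE. Qed.

Lemma rev_compP a : (0%N \notin rev a) && (sumn (rev a) == n).
Proof. by rewrite mem_rev parts_gt0 sumn_rev sumn_parts eqxx. Qed.

Definition rev_comp a : composition := Composition (rev_compP a).

Definition cstat a b : nat := (\sum_(i in descents a :&: descents b) i)%N.

Lemma rev_compK : involutive rev_comp.
Proof. by move=> a; apply/val_inj; rewrite /= revK. Qed.

Lemma partial_sums_rev a x : (x <= n)%N ->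
  x \in partial_sums a -> (n - x)%N \in partial_sums (rev a).
Proof.
move=> le_xn /mapP[k]; rewrite mem_iota add1n => /andP[k_gt0 lt_k] ->.
have s_gt0 : (0 < size a)%N by case: (size a) lt_k k_gt0 => //; case: k.
rewrite prednK // in lt_k.
apply/mapP; exists (size a - k)%N.
  by rewrite mem_iota add1n size_rev prednK // subn_gt0 lt_k ltn_subrL k_gt0.
rewrite take_rev sumn_rev subKn; last exact: ltnW.
by rewrite -{1}(sumn_parts a) -{1}(cat_take_drop k a) sumn_cat addKn.
Qed.

Lemma mem_partial_sums_rev a x : (x <= n)%N ->
  ((n - x)%N \in partial_sums (rev_comp a)) = (x \in partial_sums a).
Proof.
move=> le_xn; apply/idP/idP; last exact: partial_sums_rev.
move/(partial_sums_rev (leq_subr _ _)).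
by rewrite subKn //= revK.
Qed.

Lemma mem_descents_rev a (i j : 'I_n) : (i + j = n)%N ->
  (j \in descents (rev_comp a)) = (i \in descents a).
Proof.
move=> ijn; rewrite !inE -(@mem_partial_sums_rev a i); last exact: ltnW.
by rewrite -[X in (X - _)%N]ijn addKn.
Qed.

Lemma descents_gt0 a (i : 'I_n) : i \in descents a -> (0 < i)%N.
Proof. by rewrite inE => /partial_sums_bound/andP[]. Qed.

Lemma refines_rev a b : refines (rev_comp a) (rev_comp b) = refines a b.
Proof.
suff imp c d : refines c d -> refines (rev_comp c) (rev_comp d).
  by apply/idP/idP => [/imp|/imp //]; rewrite !rev_compK.
move=> /subsetP cd; apply/subsetP=> j jd.
have j_gt0 := descents_gt0 jd.
have n_gt0 : (0 < n)%N := ltn_trans j_gt0 (ltn_ord j).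
have lt_i : (n - j < n)%N by rewrite ltn_subrL j_gt0.
have ijn : (Ordinal lt_i + j = n)%N by rewrite /= subnK // ltnW.
by rewrite (mem_descents_rev _ ijn) cd // -(mem_descents_rev _ ijn).
Qed.

Lemma descents_size a : #|descents a| = (size a).-1.
Proof.
case: (posnP n) => [n0|n_gt0].
  rewrite (comp0 a n0); apply/eqP; rewrite cards_eq0; apply/eqP/setP=> i.
  by have := ltn_ord i; rewrite {2}n0.
rewrite -[RHS](size_iota 1) -(size_map (fun k => sumn (take k a))).
rewrite cardE -(size_map val); apply/perm_size/uniq_perm.
- by rewrite map_inj_uniq ?enum_uniq //; apply: val_inj.
- have /path_sorted := path_partial_sums a n_gt0.
  rewrite -cats1 => /cat_sorted2[+ _].
  exact: (sorted_uniq ltn_trans ltnn).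
- move=> x; apply/mapP/idP => [[j]|xP].
    by rewrite mem_enum inE => ? ->.
  have /andP[x_gt0 x_lt] := partial_sums_bound xP.
  by exists (Ordinal x_lt); rewrite // mem_enum inE.
Qed.

Lemma refines_size a b : refines a b -> (size b <= size a)%N.
Proof.
move=> /subset_leq_card; rewrite !descents_size.
case: (posnP n) => [n0|n_gt0]; first by rewrite (comp0 b n0).
have := comp_neq_nil a n_gt0; have := comp_neq_nil b n_gt0.
by rewrite -!size_eq0 -!lt0n; case: (size b) (size a) => [|?] [|?].
Qed.

End Compositions.

(* The field C(q, t). *)
Definition Cqt (R : realType) : fieldType := {fraction {poly {poly R[i]}}}.

(* Words over nat: the letter k stands for the generator h_(k+1). *)
Definition Sym (K : fieldType) := {malg K[{fmonom nat}]}.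

HB.instance Definition _ (K : fieldType) := GRing.Lalgebra.on (Sym K).

Section Ribbons.

Variable K : fieldType.

(* hgen 0 = 1 is a convention; the parts of a composition are positive. *)
Definition hgen (k : nat) : Sym K :=
  if k is k'.+1 then << fmu k' >> else 1.

Section FixedSize.

Variable n : nat.
Implicit Types (a b g : composition n).

Definition hcomp a : Sym K := \prod_(k <- a) hgen k.

(* The subtraction on nat is exact by refines_size. *)
Definition ribbon a : Sym K :=
  \sum_(b : composition n | refines a b) (-1) ^+ (size a - size b) *: hcomp b.

(* The gamma-ribbon Schur function R_a^(g)(A; s), where s is a scalar; its
   specialization at t = 1 is gamma_ribbon g a 1. *)
Definition gamma_ribbon g a (s : K) : Sym K :=
  \sum_(b : composition n |
        refines a b && (descents a :\: descents b \subset descents g))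
    s ^+ cstat a (compl_comp b) *: ribbon b.

End FixedSize.

Definition rev_word (w : {fmonom nat}) : {fmonom nat} := FMonom (rev w).

Definition word_rev : Sym K -> Sym K :=
  mmap (@mkmalgU {fmonom nat} K (@mone _)) (fun w => << rev_word w >> : Sym K).

Lemma word_rev_is_linear : linear word_rev.
Proof.
move=> c x y; rewrite /word_rev raddfD /=; congr (_ + _).
rewrite (mmapEw (msuppZ_le _ _)) mmapE scaler_sumr.
apply: eq_bigr => k _; rewrite mcoeffZ scalerAl; congr (_ * _).
by apply/malgP=> w; rewrite mcoeffZ !mcoeffU mulrnAr.
Qed.

HB.instance Definition _ :=
  GRing.isLinear.Build K (Sym K) (Sym K) _ word_rev word_rev_is_linear.

Lemma word_revU c w : word_rev << c *g w >> = << c *g rev_word w >>.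
Proof.
rewrite /word_rev mmapU.
by apply/malgP=> v; rewrite mul_malgC mcoeffZ !mcoeffU mulrnAr mulr1.
Qed.

Lemma word_revK : involutive word_rev.
Proof.
move=> x.
have -> : word_rev x = \sum_(w <- finmap.enum_fset (msupp x)) << x@_w *g rev_word w >>.
  rewrite {1}(monalgE x) linear_sum.
  by apply: eq_bigr => w _; apply: word_revU.
rewrite linear_sum [RHS]monalgE; apply: eq_bigr => w _ /=.
by rewrite word_revU /rev_word /= revK fmK.
Qed.

Lemma hcompU n (a : composition n) :
  hcomp a = << FMonom [seq k.-1 | k <- a] >>.
Proof.
rewrite /hcomp; elim: (parts a) (parts_gt0 a) => [_|[//|k] s IHs].
  by rewrite big_nil /= -fmoneE.
rewrite inE negb_or => /andP[_ s0]; rewrite big_cons (IHs s0) /=.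
rewrite [LHS]fgmulUU mulr1; congr << _ *g _ >>.
by apply/eqP; rewrite fmP fmM fmU.
Qed.

Lemma word_rev_hcomp n (a : composition n) :
  word_rev (hcomp a) = hcomp (rev_comp a).
Proof. by rewrite !hcompU word_revU /rev_word /= map_rev. Qed.

Lemma word_rev_ribbon n (a : composition n) :
  word_rev (ribbon a) = ribbon (rev_comp a).
Proof.
rewrite /ribbon linear_sum /=.
rewrite [RHS](reindex_inj (inv_inj (@rev_compK n))) /=.
apply: eq_big => [b|b _]; first by rewrite refines_rev.
by rewrite linearZ /= word_rev_hcomp !size_rev.
Qed.

Lemma omega_exists : {w : {linear Sym K -> Sym K} |
  involutive w /\
  forall n (a : composition n), w (ribbon a) = ribbon (rev_comp a)}.
Proof. by exists word_rev; split; [exact: word_revK|exact: word_rev_ribbon]. Qed.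

(* The linear involution with R_a |-> R_(rev a); see omega_unique. *)
Definition omega : {linear Sym K -> Sym K} := sval omega_exists.

Lemma omegaK : involutive omega.
Proof. exact: (proj1 (svalP omega_exists)). Qed.

Lemma omega_ribbon n (a : composition n) :
  omega (ribbon a) = ribbon (rev_comp a).
Proof. exact: (proj2 (svalP omega_exists)). Qed.

Lemma omega_unique (f g : {linear Sym K -> Sym K}) :
  (forall n (a : composition n), f (ribbon a) = g (ribbon a)) -> f =1 g.
Proof.
move=> eqR.
have eqh n (a : composition n) : f (hcomp a) = g (hcomp a).
  have [m] := ubnP #|descents a|; elim: m a => // m IHm a le_m.
  have := eqR n a; rewrite /ribbon (bigD1 a) /=; last exact: subxx.
  rewrite subnn expr0 scale1r !linearD /= !linear_sum /=.
  rewrite [X in _ + X = _](_ : _ = \sum_(b | refines a b && (b != a))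
     g ((-1) ^+ (size a - size b) *: hcomp b)); first exact: addIr.
  apply: eq_bigr => b /andP[ab ba]; rewrite !linearZ /= IHm //.
  apply: leq_trans (proper_card _) le_m.
  rewrite properEneq -/(refines a b) ab andbT.
  apply: contraNneq ba => /(congr1 (@comp_of_set n)).
  by rewrite !descentsK => ->.
move=> x; rewrite (monalgE x) !linear_sum; apply: eq_bigr => w _.
set s := [seq k.+1 | k <- (w : seq nat)].
have sP : (0%N \notin s) && (sumn s == sumn s).
  by rewrite eqxx andbT; apply/negP=> /mapP[].
have -> : << x@_w *g w >> = x@_w *: hcomp (Composition sP).
  rewrite hcompU /= /s -map_comp map_id fmK.
  by apply/malgP=> v; rewrite mcoeffZ !mcoeffU mulrnAr mulr1.
by rewrite !linearZ /= eqh.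
Qed.

End Ribbons.

(* Main.v *)
Require Import Defs.
From HB Require Import structures.
From mathcomp Require Import all_boot all_order all_algebra fraction.
From mathcomp Require Import reals complex monalg.

Set Implicit Arguments.
Unset Strict Implicit.
Unset Printing Implicit Defensive.

Local Open Scope ring_scope.

(** Reversing a composition mirrors its descent set by [i |-> n - i]. The mirror respects inclusions
    and set differences, so [b |-> rev_comp b] matches the index sets of the two sums. At [t = 1]
    all coefficients are 1, and [omega_ribbon] matches the terms. For general [t] the mirror changes
    the exponents [cstat]. *)

Lemma subset_descentsD_rev (n : nat) (a b g : composition n) :
  (descents (rev_comp a) :\: descents (rev_comp b)
     \subset descents (rev_comp g))
  = (descents a :\: descents b \subset descents g).
Proof.
have imp c d e : descents c :\: descents d \subset descents e ->
    descents (rev_comp c) :\: descents (rev_comp d)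
      \subset descents (rev_comp (n := n) e).
  move=> /subsetP cde; apply/subsetP=> j; rewrite in_setD => /andP[jd jc].
  have j_gt0 := descents_gt0 jc.
  (* The mirror image of [j] lies in ['I_n] because descents are positive. *)
  have lt_i : (n - j < n)%N.
    by rewrite ltn_subrL j_gt0 (ltn_trans j_gt0 (ltn_ord j)).
  have ijn : (Ordinal lt_i + j = n)%N by rewrite /= subnK // ltnW.
  rewrite (mem_descents_rev _ ijn) cde // in_setD.
  by rewrite -!(mem_descents_rev _ ijn) jd.
(* One implication suffices, reversal being an involution. *)
by apply/idP/idP => [/imp|/imp //]; rewrite !rev_compK.
Qed.

Theorem proposition16 (R : realType) (n : nat) (alpha gamma : composition n)
    (le_alpha_gamma : refines alpha gamma) :
  omega (Cqt R) (gamma_ribbon gamma alpha (1 : Cqt R))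
  = gamma_ribbon (rev_comp gamma) (rev_comp alpha) (1 : Cqt R).
Proof.
rewrite /gamma_ribbon GRing.linear_sum /=.
rewrite [RHS](reindex_inj (inv_inj (@rev_compK n))) /=.
apply: eq_big => [b|b _]; first by rewrite refines_rev subset_descentsD_rev.
(* The specialization enters here: powers of 1 erase the differing exponents. *)
by rewrite GRing.linearZ /= omega_ribbon !GRing.expr1n.
Qed.
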